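(* Let $\mathbb{F}$ be a field, let $G$ be a finite group of order $n$, and let $\sigma,\tau$ be $\mathbb{F}$-algebra endomorphisms of $\mathbb{F}G$ which are $\mathbb{F}$-linear extensions of group endomorphisms of $G$. Let $C_1,\dots,C_r$ be all the distinct $(\sigma,\tau)$-conjugacy classes of $G$, with representatives $x_1,\dots,x_r$ respectively. Then the dimension of $\mathrm{Inn}_{(\sigma,\tau)}(\mathbb{F}G)$ over $\mathbb{F}$ is $n-r$. If $s$ is a positive integer such that $|C_i|=1$ for all $i\in\{1,\dots,s\}$ and $|C_i|\ge 2$ for all $i\in\{s+1,\dots,r\}$, then the set $$\mathcal{B}_0=\left\{D_g\;\middle|\; g\in\bigcup_{i=s+1}^r(C_i\setminus\{x_i\})\right\}$$ is an $\mathbb{F}$-basis of $\mathrm{Inn}_{(\sigma,\tau)}(\mathbb{F}G)$.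
   Context: For $x\in G$, the $(\sigma,\tau)$-conjugacy class of $x$ in $G$ is $\{\sigma(g)x\tau(g)^{-1}\mid g\in G\}$; these classes partition $G$. For $\beta\in \mathbb{F}G$, $D_\beta: \mathbb{F}G\to \mathbb{F}G$ denotes the inner $(\sigma,\tau)$-derivation $D_\beta(\alpha)=\beta\tau(\alpha)-\sigma(\alpha)\beta$. $\mathrm{Inn}_{(\sigma,\tau)}(\mathbb{F}G)=\{D_\beta\mid\beta\in \mathbb{F}G\}$, an $\mathbb{F}$-vector space under pointwise operations. *)

(* Defs.v *)
From HB Require Import structures.
From mathcomp Require Import all_boot all_order all_fingroup all_algebra.

Set Implicit Arguments.
Unset Strict Implicit.
Unset Printing Implicit Defensive.

Import GroupScope GRing.Theory.
Local Open Scope ring_scope.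

(* The library only offers the group ring as a matrix algebra (mxrepresentation),
   not as a type carrying an algebra structure.  We build it on the functions
   gT -> F, an element being identified with its family of coefficients.  The
   alias keeps the convolution product apart from the pointwise one. *)
Definition group_algebra (F : fieldType) (gT : finGroupType) : Type :=
  {ffun gT -> F^o}.

Section GroupAlgebra.
Variables (F : fieldType) (gT : finGroupType).
Local Notation FG := (group_algebra F gT).
Implicit Types (a b c : FG) (g h x : gT).

HB.instance Definition _ := Vector.copy FG {ffun gT -> F^o}.

Definition coeff a x : F := (a : {ffun gT -> F^o}) x.

Definition ga_elt g : FG := [ffun x => (x == g)%:R : F^o].

Definition ga_mul a b : FG :=
  [ffun x => (\sum_(g : gT) coeff a g * coeff b (g^-1 * x)%g) : F^o].

Lemma coeffP a b : coeff a =1 coeff b -> a = b.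
Proof. by move=> eq_ab; apply/ffunP. Qed.

Lemma coeffD a b x : coeff (a + b) x = coeff a x + coeff b x.
Proof. by rewrite /coeff ffunE. Qed.

Lemma coeffZ (k : F) a x : coeff (k *: a) x = k * coeff a x.
Proof. by rewrite /coeff ffunE. Qed.

Lemma coeff_elt g x : coeff (ga_elt g) x = (x == g)%:R.
Proof. by rewrite /coeff ffunE. Qed.

Lemma coeffM a b x :
  coeff (ga_mul a b) x = \sum_(g : gT) coeff a g * coeff b (g^-1 * x)%g.
Proof. by rewrite {1}/coeff ffunE. Qed.

Fact ga_mulA : associative ga_mul.
Proof.
move=> a b c; apply: coeffP => x; rewrite !coeffM.
under eq_bigr => g _ do rewrite coeffM mulr_sumr.
under [RHS]eq_bigr => k _ do rewrite coeffM mulr_suml.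
rewrite [RHS]exchange_big /=; apply: eq_bigr => g _.
rewrite [RHS](reindex_inj (mulgI g)) /=; apply: eq_bigr => h _.
by rewrite mulKg invMg mulgA mulrA.
Qed.

Fact ga_mul1l : left_id (ga_elt 1%g) ga_mul.
Proof.
move=> a; apply: coeffP => x; rewrite coeffM (bigD1 1%g) //= big1 => [|g ng1].
  by rewrite coeff_elt eqxx invg1 mul1g mul1r addr0.
by rewrite coeff_elt (negPf ng1) mul0r.
Qed.

Fact ga_mul1r : right_id (ga_elt 1%g) ga_mul.
Proof.
move=> a; apply: coeffP => x; rewrite coeffM (bigD1 x) //= big1 => [|g ngx].
  by rewrite coeff_elt mulVg eqxx mulr1 addr0.
by rewrite coeff_elt -eq_mulVg1 (negPf ngx) mulr0.
Qed.

Fact ga_mulDl : left_distributive ga_mul +%R.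
Proof.
move=> a b c; apply: coeffP => x; rewrite coeffD !coeffM -big_split /=.
by apply: eq_bigr => g _; rewrite coeffD mulrDl.
Qed.

Fact ga_mulDr : right_distributive ga_mul +%R.
Proof.
move=> a b c; apply: coeffP => x; rewrite coeffD !coeffM -big_split /=.
by apply: eq_bigr => g _; rewrite coeffD mulrDr.
Qed.

Fact ga_elt1_neq0 : ga_elt 1%g != 0.
Proof.
apply/eqP => /(congr1 (coeff^~ 1%g)); rewrite coeff_elt eqxx /coeff ffunE.
by move/eqP; rewrite oner_eq0.
Qed.

HB.instance Definition _ := GRing.Zmodule_isNzRing.Build FG
  ga_mulA ga_mul1l ga_mul1r ga_mulDl ga_mulDr ga_elt1_neq0.

Fact ga_scaleAl (k : F) a b : k *: (a * b) = (k *: a) * b.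
Proof.
apply: coeffP => x; rewrite coeffZ !coeffM mulr_sumr.
by apply: eq_bigr => g _; rewrite coeffZ mulrA.
Qed.

HB.instance Definition _ := GRing.Lmodule_isLalgebra.Build F FG ga_scaleAl.

Fact ga_scaleAr (k : F) a b : k *: (a * b) = a * (k *: b).
Proof.
apply: coeffP => x; rewrite coeffZ !coeffM mulr_sumr.
by apply: eq_bigr => g _; rewrite coeffZ mulrCA.
Qed.

HB.instance Definition _ := GRing.Lalgebra_isAlgebra.Build F FG ga_scaleAr.

Lemma ga_eltM g h : ga_elt (g * h)%g = ga_elt g * ga_elt h.
Proof.
apply: coeffP => x; rewrite coeffM (bigD1 g) //= big1 => [|k nkg].
  by rewrite !coeff_elt eqxx mul1r addr0 (canF_eq (mulKVg g)).
by rewrite coeff_elt (negPf nkg) mul0r.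
Qed.

Lemma ga_elt1 : ga_elt 1%g = 1. Proof. by []. Qed.

Lemma ga_sumE a : a = \sum_(g : gT) coeff a g *: ga_elt g.
Proof.
apply: coeffP => x; rewrite {2}/coeff sum_ffunE (bigD1 x) //= big1 => [|g ngx].
  by rewrite addr0 ffunE ffunE eqxx [_ *: _]mulr1.
by rewrite !ffunE eq_sym (negPf ngx) scaler0.
Qed.

End GroupAlgebra.

(* f is the F-linear extension of phi: linearity of f is part of its type, and
   the group elements span the group algebra. *)
Definition extends_group_endo (F : fieldType) (gT : finGroupType)
    (f : {lrmorphism group_algebra F gT -> group_algebra F gT})
    (phi : {morphism [set: gT] >-> gT}) : Prop :=
  forall g : gT, f (ga_elt F g) = ga_elt F (phi g).

Definition twisted_class (gT : finGroupType)
    (phi psi : {morphism [set: gT] >-> gT}) (x : gT) : {set gT} :=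
  [set (phi g * x * (psi g)^-1)%g | g : gT].

Definition twisted_classes (gT : finGroupType)
    (phi psi : {morphism [set: gT] >-> gT}) : {set {set gT}} :=
  [set twisted_class phi psi x | x : gT].

Section InnerDerivations.
Variables (F : fieldType) (gT : finGroupType).
Local Notation FG := (group_algebra F gT).
Variables sigma tau : {lrmorphism FG -> FG}.

Definition inner_der_fun (b a : FG) : FG := b * tau a - sigma a * b.

Fact inner_der_fun_linear b : linear (inner_der_fun b).
Proof.
move=> k u v; rewrite /inner_der_fun !linearP mulrDr mulrDl -scalerAr -scalerAl.
by rewrite scalerBr opprD addrACA.
Qed.

HB.instance Definition _ b := GRing.isLinear.Build F FG FG *:%R
  (inner_der_fun b) (inner_der_fun_linear b).

Definition inner_der (b : FG) : 'End(FG) := linfun (inner_der_fun b).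

Lemma inner_derE b a : inner_der b a = b * tau a - sigma a * b.
Proof. by rewrite lfunE. Qed.

Fact inner_der_linear : linear inner_der.
Proof.
move=> k u v; apply/lfunP => a; rewrite add_lfunE scale_lfunE !inner_derE.
by rewrite mulrDr mulrDl scalerBr scalerAl scalerAr opprD addrACA.
Qed.

HB.instance Definition _ := GRing.isLinear.Build F FG 'End(FG) *:%R
  inner_der inner_der_linear.

(* The set of all inner_der b, as a subspace of 'End(FG); see innP. *)
Definition Inn : {vspace 'End(FG)} := limg (linfun inner_der).

Lemma innP (f : 'End(FG)) : reflect (exists b, f = inner_der b) (f \in Inn).
Proof.
apply: (iffP memv_imgP) => [[b _ ->] | [b ->]]; exists b.
- by rewrite lfunE.
- exact: memvf.
- by rewrite lfunE.
Qed.

End InnerDerivations.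

(* Main.v *)
Require Import Defs.
From HB Require Import structures.
From mathcomp Require Import all_boot all_order all_fingroup all_algebra.

(** The map D : b |-> D_b is linear from FG onto Inn, so everything rests on its
    kernel.  As sigma and tau send group elements to group elements, comparing
    coefficients in b * psi(g) = phi(g) * b shows that D_b = 0 exactly when the
    coefficients of b are constant on the twisted classes of G
    ([inner_der_eq0]).

    Let X contain one point of each twisted class.  A function constant on the
    classes is determined by its values on X, and these values are arbitrary.
    Hence each b is, modulo ker D, a unique combination of the group elements
    outside X, and the D_g with g outside X form a basis of Inn
    ([inner_der_basis]); there are n - r of them.  A class with one element lies
    inside X, so the elements outside X are precisely those of the sets C_i
    minus x_i with |C_i| >= 2. *)

Set Implicit Arguments.
Unset Strict Implicit.
Unset Printing Implicit Defensive.

Import GroupScope GRing.Theory.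
Local Open Scope ring_scope.

Lemma free_image (K : fieldType) (vT : vectType K) (I : finType) (A : {set I})
    (f : I -> vT) :
  (forall k : I -> K, \sum_(i in A) k i *: f i = 0 -> {in A, forall i, k i = 0}) ->
  free [seq f i | i in A].
Proof.
move=> indep; apply/(freeP (X := image_tuple f A)) => k sum0 j.
have Aj := enum_valP j.
pose k' i := k (enum_rank_in Aj i).
have k'E i : k' (enum_val i) = k i by rewrite /k' enum_valK_in.
rewrite -k'E; apply: indep => //; rewrite big_enum_val -[RHS]sum0 /=.
by apply: eq_bigr => i _; rewrite k'E nth_image.
Qed.

Section TwistedClasses.
Variables (gT : finGroupType) (phi psi : {morphism [set: gT] >-> gT}).
Implicit Types (g x y : gT) (X : {set gT}).
Local Notation cl := (twisted_class phi psi).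
Local Notation classes := (twisted_classes phi psi).

Lemma twisted_class_refl x : x \in cl x.
Proof. by apply/imsetP; exists 1%g; rewrite // !morph1 mul1g invg1 mulg1. Qed.

Lemma mem_twisted_class g x : (phi g * x * (psi g)^-1)%g \in cl x.
Proof. exact: imset_f. Qed.

(** Twisted classes are the orbits of an action of G on itself, as phi and psi
    are multiplicative. *)
Lemma twisted_class_eq x y : y \in cl x -> cl y = cl x.
Proof.
case/imsetP=> h _ ->; apply/setP=> z; apply/imsetP/imsetP => -[g _ ->].
  exists (g * h)%g => //.
  by rewrite !morphM ?inE // invMg !mulgA.
exists (g * h^-1)%g => //.
by rewrite !morphM ?morphV ?inE // invMg invgK !mulgA !mulgKV.
Qed.

Lemma twisted_classes_partition : partition classes [set: gT].
Proof.
have eqiR: {in [set: gT] & &, equivalence_rel (fun x y => y \in cl x)}.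
  move=> x y z _ _ _; split; first exact: twisted_class_refl.
  by move/twisted_class_eq->.
congr (is_true (partition _ _)): (equivalence_partitionP eqiR).
apply/setP=> B; apply/imsetP/imsetP => -[x _ ->]; exists x => //;
  by apply/setP=> y; rewrite !inE.
Qed.

End TwistedClasses.

Section InnerDerivations.
Variables (F : fieldType) (gT : finGroupType).
Local Notation FG := (group_algebra F gT).
Variables (sigma tau : {lrmorphism FG -> FG}).
Variables (phi psi : {morphism [set: gT] >-> gT}).
Hypotheses (sigma_ext : extends_group_endo sigma phi)
           (tau_ext : extends_group_endo tau psi).
Implicit Types (a b : FG) (g h x y : gT) (X : {set gT}).
Local Notation elt := (ga_elt F).
Local Notation D := (inner_der sigma tau).
Local Notation cl := (twisted_class phi psi).
Local Notation classes := (twisted_classes phi psi).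

Lemma coeff_mul_elt b h x : coeff (b * elt h) x = coeff b (x * h^-1)%g.
Proof.
rewrite coeffM (bigD1 (x * h^-1)%g) //= big1 => [|g ng].
  by rewrite coeff_elt invMg invgK mulgKV eqxx mulr1 addr0.
rewrite coeff_elt; case: eqP => [eh|_]; last by rewrite mulr0.
by case/eqP: ng; rewrite -eh invMg invgK mulKVg.
Qed.

Lemma coeff_elt_mul b h x : coeff (elt h * b) x = coeff b (h^-1 * x)%g.
Proof.
rewrite coeffM (bigD1 h) //= big1 => [|g ng].
  by rewrite coeff_elt eqxx mul1r addr0.
by rewrite coeff_elt (negPf ng) mul0r.
Qed.

Lemma coeff_inner_der_elt b g x :
  coeff (D b (elt g)) x
    = coeff b (x * (psi g)^-1)%g - coeff b ((phi g)^-1 * x)%g.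
Proof.
rewrite inner_derE sigma_ext tau_ext -scaleN1r coeffD coeffZ mulN1r.
by rewrite coeff_mul_elt coeff_elt_mul.
Qed.

Lemma coeff0 x : coeff (0 : FG) x = 0.
Proof. by rewrite -(scale0r 0) coeffZ mul0r. Qed.

(** It is enough to test D_b on the group elements g; the coefficient of D_b(g)
    at phi(g) x is the difference of the coefficients of b at
    phi(g) x psi(g)^-1 and at x. *)
Lemma inner_der_eq0 b :
  D b = 0 <-> (forall x, {in cl x, forall y, coeff b y = coeff b x}).
Proof.
have zeroE a : (0 : 'End(FG)) a = 0 by exact: lfunE.
split=> [Db0 x _ /imsetP[g _ ->] | class_b].
  have := coeff_inner_der_elt b g (phi g * x)%g.
  by rewrite Db0 zeroE coeff0 mulKg => /esym/subr0_eq.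
apply/lfunP=> a; rewrite zeroE (ga_sumE a) linear_sum.
apply: big1 => g _; rewrite linearZ /=.
suff -> : D b (elt g) = 0 by exact: scaler0.
apply: coeffP => x; rewrite coeff_inner_der_elt coeff0; apply/eqP.
rewrite subr_eq0 -(class_b ((phi g)^-1 * x)%g (x * (psi g)^-1)%g) //.
by rewrite -{1}(mulKVg (phi g) x) mem_twisted_class.
Qed.

Lemma coeff_sum_elt (A : {set gT}) (k : gT -> F) x :
  coeff (\sum_(g in A) k g *: elt g) x = if x \in A then k x else 0.
Proof.
have coeff_sum: coeff (\sum_(g in A) k g *: elt g) x
                  = \sum_(g in A) coeff (k g *: elt g) x.
  by rewrite /coeff sum_ffunE.
rewrite coeff_sum; case: ifPn => [Ax | Ax].
  rewrite (bigD1 x) //= coeffZ coeff_elt eqxx mulr1 big1 ?addr0 // => g.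
  by case/andP=> _ ng; rewrite coeffZ coeff_elt eq_sym (negPf ng) mulr0.
apply: big1 => g Ag; rewrite coeffZ coeff_elt.
by case: eqP Ax => [->|]; rewrite ?Ag ?mulr0.
Qed.

Lemma inner_derD b c : D (b + c) = D b + D c.
Proof. by have := inner_der_linear sigma tau 1 b c; rewrite !scale1r. Qed.

Lemma inner_der_sum_elt (A : {set gT}) (k : gT -> F) :
  D (\sum_(g in A) k g *: elt g) = \sum_(g in A) k g *: D (elt g).
Proof.
apply/lfunP=> a; rewrite sum_lfunE inner_derE mulr_suml mulr_sumr -sumrB.
apply: eq_bigr => g _.
by rewrite scale_lfunE inner_derE -scalerAl -scalerAr scalerBr.
Qed.

(** The span of the group elements outside X is a complement of ker D.  It
    meets ker D trivially because an element of ker D vanishing on X vanishes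
    on every class; together they span FG because subtracting from b the class
    function that agrees with b on X does not change D_b. *)
Lemma inner_der_basis X : is_transversal X classes [set: gT] ->
  basis_of (Inn sigma tau) [seq D (elt g) | g in ~: X].
Proof.
move=> trX; pose rep y := transversal_repr 1%g X (cl y).
have clP y : cl y \in classes by apply: imset_f.
have repX y : rep y \in X by apply: (repr_mem_transversal trX).
have rep_cl y : rep y \in cl y by apply: (repr_mem_pblock trX).
have rep_id y : y \in X -> rep y = y.
  move=> Xy; apply/esym/set1P.
  by rewrite -(setI_transversal_pblock trX) // inE Xy twisted_class_refl.
rewrite basisEdim; apply/andP; split; last first.
  (* freeness is converted into the dimension bound that basisEdim asks for *)
  rewrite -(eqP (_ : free _)); last first.
    apply: free_image => k sum0 g; rewrite inE => nXg.
    pose b : FG := \sum_(h in ~: X) k h *: elt h.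
    have /inner_der_eq0 class_b : D b = 0.
      by rewrite inner_der_sum_elt.
    have := class_b g _ (rep_cl g).
    by rewrite !coeff_sum_elt !inE repX nXg => <-.
  apply: dimvS; apply/span_subvP => _ /imageP[g _ ->].
  by apply/innP; exists (elt g).
apply/subvP => _ /innP[b ->].
pose c : FG := [ffun y => coeff b (rep y) : F^o].
have coeff_c y : coeff c y = coeff b (rep y) by rewrite /coeff ffunE.
have Dc0 : D c = 0.
  by apply/inner_der_eq0=> x y xy; rewrite !coeff_c /rep (twisted_class_eq xy).
have ->: b = \sum_(g in ~: X) (coeff b g - coeff c g) *: elt g + c.
  apply: coeffP => x; rewrite coeffD coeff_sum_elt inE coeff_c.
  by case: (boolP (x \in X)) => [/rep_id-> | _]; rewrite ?add0r ?subrK.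
rewrite inner_derD Dc0 addr0 inner_der_sum_elt.
by apply: memv_suml => g nXg; rewrite memvZ // memv_span // image_f.
Qed.

End InnerDerivations.

Theorem corollary4p16 (F : fieldType) (gT : finGroupType) (n : nat)
  (ordG : #|[set: gT]| = n)
  (sigma tau : {lrmorphism group_algebra F gT -> group_algebra F gT})
  (phi psi : {morphism [set: gT] >-> gT})
  (sigma_ext : extends_group_endo sigma phi)
  (tau_ext : extends_group_endo tau psi)
  (r : nat) (C : 'I_r -> {set gT}) (x : 'I_r -> gT)
  (C_distinct : injective C)
  (C_all : [set C i | i : 'I_r] = twisted_classes phi psi)
  (x_repr : forall i : 'I_r, x i \in C i) :
  \dim (Inn sigma tau) = (n - r)%N
  /\ forall s : nat, (0 < s <= r)%N ->
     (forall i : 'I_r, (i < s)%N -> #|C i| = 1%N) ->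
     (forall i : 'I_r, (s <= i)%N -> (2 <= #|C i|)%N) ->
     basis_of (Inn sigma tau)
       [seq inner_der sigma tau (ga_elt F g)
          | g in \bigcup_(i : 'I_r | (s <= i)%N) (C i :\ x i)].
Proof.
have part := twisted_classes_partition phi psi.
have [coverC trivC _] := and3P part.
have C_class i : C i \in twisted_classes phi psi by rewrite -C_all imset_f.
have C_disj i j y : y \in C i -> y \in C j -> i = j.
  move=> Ciy Cjy; apply: C_distinct.
  by rewrite -(def_pblock trivC _ Ciy) // -(def_pblock trivC _ Cjy).
have C_cover y : exists i, y \in C i.
  have : y \in cover (twisted_classes phi psi) by rewrite (eqP coverC).
  by case/bigcupP=> B; rewrite -C_all => /imsetP[i _ ->]; exists i.
pose X := [set x i | i : 'I_r].
have X_C i y : y \in C i -> (y \in X) = (y == x i).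
  move=> Ciy; apply/imsetP/eqP => [[j _ yE] | ->]; last by exists i.
  by rewrite yE (C_disj _ _ _ Ciy (_ : y \in C j)) ?yE.
have trX : is_transversal X (twisted_classes phi psi) [set: gT].
  apply/and3P; split=> //; apply/forall_inP=> B.
  rewrite -C_all => /imsetP[i _ ->]; apply/cards1P; exists (x i).
  apply/setP=> y; rewrite !inE andbC; case: (boolP (y \in C i)) => [/X_C //|].
  by move=> nCy; apply/esym/(contraNF _ nCy) => /eqP->.
have basisX := inner_der_basis sigma_ext tau_ext trX.
split=> [|s _ small _].
  rewrite (size_basis (X := image_tuple _ _) basisX) cardsCs setCK.
  by rewrite (card_transversal trX) -C_all card_imset // card_ord -cardsT ordG.
suff -> : \bigcup_(i : 'I_r | (s <= i)%N) (C i :\ x i) = ~: X by [].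
apply/setP=> y; have [i Ciy] := C_cover y; rewrite inE (X_C i) //.
apply/bigcupP/idP => [[j _ /setD1P[nyx Cjy]] | nyx].
  by rewrite (C_disj _ _ _ Ciy Cjy).
exists i; last by rewrite !inE nyx.
(* y and x i are two distinct points of C i *)
rewrite leqNgt; apply/negP=> /small/eqP/cards1P[z Ci1].
by case/eqP: nyx; move: Ciy (x_repr i); rewrite Ci1 !inE => /eqP-> /eqP->.
Qed.
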